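(* Both problems $(P_{\le k})$ and $(P_{\ge k})$ can be (polynomially) reduced to the weighted matroid intersection problem.
   Context: An instance consists of two matroids $\mathcal{M}_1=(E,\mathcal{B}_1)$, $\mathcal{M}_2=(E,\mathcal{B}_2)$ on a common finite ground set $E$ with base sets $\mathcal{B}_1,\mathcal{B}_2$, each given by an independence oracle, an integer $k$ with $0\le k\le K:=\min\{\operatorname{rk}(\mathcal{M}_1),\operatorname{rk}(\mathcal{M}_2)\}$, and cost functions $c_1,c_2\colon E\to\mathbb{R}$. Write $c_i(S)=\sum_{e\in S}c_i(e)$. Problem $(P_{\le k})$: minimize $c_1(X)+c_2(Y)$ over $X\in\mathcal{B}_1$, $Y\in\mathcal{B}_2$ subject to $|X\cap Y|\le k$. Problem $(P_{\ge k})$: minimize $c_1(X)+c_2(Y)$ over $X\in\mathcal{B}_1$, $Y\in\mathcal{B}_2$ subject to $|X\cap Y|\ge k$. Weighted matroid intersection problem: given two matroids $\mathcal{N}_1=(\tilde E,\tilde{\mathcal{F}}_1)$, $\mathcal{N}_2=(\tilde E,\tilde{\mathcal{F}}_2)$ on a common ground set (with families of independent sets $\tilde{\mathcal{F}}_1,\tilde{\mathcal{F}}_2$, given by independence oracles) and weights $w\colon\tilde E\to\mathbb{R}$, maximize $\sum_{e\in A}w(e)$ over $A\in\tilde{\mathcal{F}}_1\cap\tilde{\mathcal{F}}_2$. ''Reduced'' means: from any instance of the given problem one can construct in polynomial time an instance of weighted matroid intersection (whose independence oracles are simulated in polynomial time using the oracles of $\mathcal{M}_1,\mathcal{M}_2$)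 such that from any optimal solution of the latter one obtains in polynomial time an optimal solution of the former, or the conclusion that the former is infeasible. *)

(* Defs.v *)
From mathcomp Require Import all_boot all_order all_algebra.
From mathcomp Require Import reals.

Set Implicit Arguments.
Unset Strict Implicit.
Unset Printing Implicit Defensive.

Import Order.TTheory GRing.Theory Num.Theory.

Record matroid (T : finType) := Matroid {
  indep : {set {set T}};
  indep0 : set0 \in indep;
  indepS : forall A B : {set T}, A \subset B -> B \in indep -> A \in indep;
  indep_aug : forall A B : {set T}, A \in indep -> B \in indep ->
    #|A| < #|B| -> exists2 x, x \in B :\: A & x |: A \in indep }.

Definition bases (T : finType) (M : matroid T) : {set {set T}} :=
  [set B | maxset (fun A => A \in indep M) B].

Definition rk (T : finType) (M : matroid T) : nat :=
  \max_(A in indep M) #|A|.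

Definition setcost (R : realType) (T : finType) (c : T -> R) (S : {set T}) : R :=
  (\sum_(e in S) c e)%R.

(* Ground sets are presented to algorithms as {0, ..., n-1}. *)
Record instance (R : realType) := Instance {
  isize : nat;
  mat1 : matroid 'I_isize;
  mat2 : matroid 'I_isize;
  bound : nat;
  cost1 : 'I_isize -> R;
  cost2 : 'I_isize -> R;
  bound_le : bound <= minn (rk mat1) (rk mat2) }.

(* [cmp #|X :&: Y| k] is the cardinality constraint of the problem. *)
Definition feasible (cmp : rel nat) (R : realType) (I : instance R)
    (X Y : {set 'I_(isize I)}) : Prop :=
  [/\ X \in bases (mat1 I), Y \in bases (mat2 I) & cmp #|X :&: Y| (bound I)].
Arguments feasible cmp {R} I X Y.

Definition objective (R : realType) (I : instance R)
    (X Y : {set 'I_(isize I)}) : R :=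
  (setcost (@cost1 R I) X + setcost (@cost2 R I) Y)%R.
Arguments objective {R} I X Y.

Definition optimal (cmp : rel nat) (R : realType) (I : instance R)
    (X Y : {set 'I_(isize I)}) : Prop :=
  feasible cmp I X Y /\
  forall X' Y', feasible cmp I X' Y' -> (objective I X Y <= objective I X' Y')%R.
Arguments optimal cmp {R} I X Y.

Definition infeasible (cmp : rel nat) (R : realType) (I : instance R) : Prop :=
  forall X Y : {set 'I_(isize I)}, ~ feasible cmp I X Y.
Arguments infeasible cmp {R} I.

Definition P_le : rel nat := fun m k => m <= k.
Definition P_ge : rel nat := fun m k => m >= k.

Record wmi_instance (R : realType) := WmiInstance {
  wsize : nat;
  wmat1 : matroid 'I_wsize;
  wmat2 : matroid 'I_wsize;
  weight : 'I_wsize -> R }.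

Definition wmi_feasible (R : realType) (J : wmi_instance R)
    (A : {set 'I_(wsize J)}) : bool :=
  A \in indep (wmat1 J) :&: indep (wmat2 J).
Arguments wmi_feasible {R} J A.

Definition wmi_optimal (R : realType) (J : wmi_instance R)
    (A : {set 'I_(wsize J)}) : Prop :=
  wmi_feasible J A /\
  forall A', wmi_feasible J A' ->
    (setcost (@weight R J) A' <= setcost (@weight R J) A)%R.
Arguments wmi_optimal {R} J A.

(* Model of computation: structured programs for a real RAM with two
   independence oracles.  The memory consists of arrays of naturals and arrays
   of reals; a scalar is an array of which only cell 0 is used.
   Every elementary command, test and oracle call costs one step; the
   expressions of a program have constant size, so this is the usual unit cost
   up to a constant factor.
   The only arithmetic operations are addition, subtraction and comparison, so
   that unit cost is not abused: numbers of exponential bit length cannot be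
   produced in polynomially many steps, and for rational costs polynomially
   many steps are also polynomial time on a Turing machine.  Reals cannot be
   rounded or otherwise converted to naturals. *)

Inductive nexp :=
  | NConst of nat
  | NGet of nat & nexp        (* NGet a i : cell i of array a *)
  | NAdd of nexp & nexp
  | NSub of nexp & nexp.      (* truncated *)

Inductive rexp :=
  | RConst of nat
  | RGet of nat & nexp
  | RAdd of rexp & rexp
  | RSub of rexp & rexp.

Inductive bexp :=
  | NLe of nexp & nexp
  | RLe of rexp & rexp
  | BNot of bexp
  | BAnd of bexp & bexp.

Inductive cmd :=
  | Skip
  | NSet of nat & nexp & nexp       (* NSet a i e : a[i] := e *)
  | RSet of nat & nexp & rexp
  | Query of bool & nat & nat
      (* Query o q a : a[0] := answer of the first (o = false) or the second
         (o = true) oracle on the set whose characteristic vector is q *)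
  | Seq of cmd & cmd
  | If of bexp & cmd & cmd
  | While of bexp & cmd.

Record store (R : realType) := Store {
  nmem : nat -> nat -> nat;
  rmem : nat -> nat -> R }.

Definition upd (V : Type) (mem : nat -> nat -> V) (a i : nat) (v : V) :
    nat -> nat -> V :=
  fun b j => if (b == a) && (j == i) then v else mem b j.

Section Semantics.
Variable R : realType.

Fixpoint neval (s : store R) (e : nexp) : nat :=
  match e with
  | NConst m => m
  | NGet a i => nmem s a (neval s i)
  | NAdd e1 e2 => neval s e1 + neval s e2
  | NSub e1 e2 => neval s e1 - neval s e2
  end.

Fixpoint reval (s : store R) (e : rexp) : R :=
  match e with
  | RConst m => m%:R%R
  | RGet a i => rmem s a (neval s i)
  | RAdd e1 e2 => (reval s e1 + reval s e2)%R
  | RSub e1 e2 => (reval s e1 - reval s e2)%R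
  end.

Fixpoint beval (s : store R) (b : bexp) : bool :=
  match b with
  | NLe e1 e2 => neval s e1 <= neval s e2
  | RLe e1 e2 => (reval s e1 <= reval s e2)%R
  | BNot b1 => ~~ beval s b1
  | BAnd b1 b2 => beval s b1 && beval s b2
  end.

(* [exec O c s t s'] : started in [s], the program [c] halts in [s'] after
   exactly [t] steps. *)
Inductive exec (O : bool -> (nat -> nat) -> bool) :
    cmd -> store R -> nat -> store R -> Prop :=
  | ExecSkip s : exec O Skip s 1 s
  | ExecNSet a i e s :
      exec O (NSet a i e) s 1
        (Store (upd (nmem s) a (neval s i) (neval s e)) (rmem s))
  | ExecRSet a i e s :
      exec O (RSet a i e) s 1
        (Store (nmem s) (upd (rmem s) a (neval s i) (reval s e)))
  | ExecQuery o q a s :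
      exec O (Query o q a) s 1
        (Store (upd (nmem s) a 0 (nat_of_bool (O o (nmem s q)))) (rmem s))
  | ExecSeq c1 c2 s t1 s1 t2 s2 :
      exec O c1 s t1 s1 -> exec O c2 s1 t2 s2 ->
      exec O (Seq c1 c2) s (t1 + t2) s2
  | ExecIf b c1 c2 s t s' :
      exec O (if beval s b then c1 else c2) s t s' ->
      exec O (If b c1 c2) s t.+1 s'
  | ExecWhileFalse b c s :
      ~~ beval s b -> exec O (While b c) s 1 s
  | ExecWhileTrue b c s t1 s1 t2 s2 :
      beval s b -> exec O c s t1 s1 -> exec O (While b c) s1 t2 s2 ->
      exec O (While b c) s (t1 + t2).+1 s2.

End Semantics.

Definition decode_set (n : nat) (v : nat -> nat) : {set 'I_n} :=
  [set i : 'I_n | v i != 0].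

Definition encode_set (n : nat) (S : {set 'I_n}) : nat -> nat :=
  fun j => if insub j is Some i then nat_of_bool (i \in S) else 0.

Definition encode_fun (R : realType) (n : nat) (c : 'I_n -> R) : nat -> R :=
  fun j => if insub j is Some i then c i else 0%R.

Definition oracle_of (R : realType) (I : instance R) (o : bool) (v : nat -> nat) :
    bool :=
  decode_set (isize I) v \in indep (if o then mat2 I else mat1 I).

(* Initial memory: n and k in natural arrays 0 and 1, the costs in real arrays
   0 and 1, and an auxiliary characteristic vector [v] in natural array 2.  The
   matroids are accessible only through [oracle_of]. *)
Definition initial (R : realType) (I : instance R) (v : nat -> nat) : store R :=
  Store
    (fun a j => if (a == 0) && (j == 0) then isize I
                else if (a == 1) && (j == 0) then bound I
                else if a == 2 then v j else 0)
    (fun a j => if a == 0 then encode_fun (@cost1 R I) j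
                else if a == 1 then encode_fun (@cost2 R I) j else 0%R).

(* Running [c] on the instance [I] and the auxiliary vector [v] takes at most
   [T] steps and yields a memory satisfying [Q]; [exec] is deterministic. *)
Definition runs_within (R : realType) (I : instance R) (c : cmd)
    (v : nat -> nat) (T : nat) (Q : store R -> Prop) : Prop :=
  exists t s, [/\ exec (oracle_of I) c (initial I v) t s, t <= T & Q s].

Definition outputs_wmi (R : realType) (J : wmi_instance R) (s : store R) : Prop :=
  nmem s 0 0 = wsize J /\ forall i : 'I_(wsize J), rmem s 0 i = weight i.

Definition outputs_bool (R : realType) (b : bool) (s : store R) : Prop :=
  (nmem s 0 0 != 0) = b.

(* Cell 0 of array 0 tells whether a solution is returned; if so, it is stored
   in arrays 1 and 2. *)
Definition outputs_solution (cmp : rel nat) (R : realType) (I : instance R)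
    (s : store R) : Prop :=
  if nmem s 0 0 != 0 then
    optimal cmp I (decode_set (isize I) (nmem s 1)) (decode_set (isize I) (nmem s 2))
  else infeasible cmp I.
Arguments outputs_solution cmp {R} I s.

(* [construct] computes the size and the weights of the new instance,
   [sim1] and [sim2] simulate its independence oracles, and [extract] turns an
   optimal solution of it into the answer for the original instance.  The
   programs and the polynomial are the same for all instances.  The size of the
   new instance is bounded explicitly, since its weights need not all be
   written. *)
Definition reducible_to_wmi (R : realType) (cmp : rel nat) : Prop :=
  exists (construct sim1 sim2 extract : cmd) (p : {poly nat}),
  forall I : instance R, exists J : wmi_instance R,
    let T := p.[isize I]%R in
    [/\ wsize J <= T,
        runs_within I construct (fun=> 0) T (outputs_wmi J),
        forall S : {set 'I_(wsize J)},
          runs_within I sim1 (encode_set S) T (outputs_bool (S \in indep (wmat1 J))) /\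
          runs_within I sim2 (encode_set S) T (outputs_bool (S \in indep (wmat2 J)))
      & forall A : {set 'I_(wsize J)}, wmi_optimal J A ->
          runs_within I extract (encode_set A) T (outputs_solution cmp I)].

(* Main.v *)
Require Import Defs.
From mathcomp Require Import all_boot all_order all_algebra.
From mathcomp Require Import reals zify lra.

(** Both problems become weighted matroid intersection on two disjoint copies
    of the ground set, so that a pair (X, Y) is the single set X + Y.

    For the constraint [#|X :&: Y| <= k], the first matroid is the direct sum of
    M1 and M2 ([direct_sum]).  The second one consists of the sets that contain
    both copies of at most k elements ([few_pairs]): its independent sets are
    the sets of nullity at most k in the partition matroid whose parts are the
    pairs of copies, so it is an elongation of a matroid.  Giving each element
    the weight C minus its cost, where C exceeds the sum of all absolute costs,
    makes cardinality the primary objective ([big_weight_mono]).  An optimal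
    common independent set thus consists of two bases as soon as some feasible
    pair of bases exists, and is then a cheapest one ([wmi_of_optimal]).

    The constraint [#|X :&: Y| >= k] is reduced to the previous one by duality:
    [Y] is a base of M2 iff [~: Y] is a base of the dual matroid, replacing [Y]
    by [~: Y] negates its cost up to a constant, and
    [#|X :&: ~: Y| = rk M1 - #|X :&: Y|].  The Boolean [delta] tells whether M2
    is dualized in this way, which treats both problems at once
    ([reduced_correct]).

    It remains to write programs.  All loops are over the ground set, so a
    single rule for counting loops ([runs_for]) gives both correctness and a
    linear number of steps.  The only nontrivial algorithm is the greedy
    computation of the rank of a set ([runs_rank]); it decides independence in
    the dual matroid, yields the bound on the number of pairs when M2 is
    dualized, and lets the extraction recognize bases.  A solution is declared
    exactly when the two parts of the given optimal set describe two bases. *)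

Set Implicit Arguments.
Unset Strict Implicit.
Unset Printing Implicit Defensive.

Import Order.TTheory GRing.Theory Num.Theory.

(** * Rank and duality in matroids *)

Section Rank.
Variables (T : finType) (M : matroid T).
Implicit Types A B D S : {set T}.

Definition rank D := \max_(A in indep M | A \subset D) #|A|.

Lemma rankT : rank [set: T] = rk M.
Proof. by apply: eq_bigl => A; rewrite subsetT andbT. Qed.

Lemma leq_rank A D : A \in indep M -> A \subset D -> #|A| <= rank D.
Proof.
move=> iA sAD.
by apply: (@leq_bigmax_cond _ _ (fun A : {set T} => #|A|)); rewrite iA.
Qed.

Lemma rank_leq_card D : rank D <= #|D|.
Proof. by apply/bigmax_leqP => A /andP[_ /subset_leq_card]. Qed.

Lemma rank_indep A : A \in indep M -> rank A = #|A|.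
Proof. by move=> iA; apply/eqP; rewrite eqn_leq rank_leq_card leq_rank. Qed.

Lemma rank_leq_rk D : rank D <= rk M.
Proof.
apply/bigmax_leqP => A /andP[iA _].
by rewrite -rankT leq_rank ?subsetT.
Qed.

Lemma rank_attained D : exists A, [/\ A \in indep M, A \subset D & #|A| = rank D].
Proof.
have [|A /andP[iA sAD] cA] := @eq_bigmax_cond _
  [pred A : {set T} | (A \in indep M) && (A \subset D)] (fun A => #|A|).
  by apply/card_gt0P; exists set0; rewrite inE indep0 sub0set.
by exists A; split=> //; rewrite -cA; apply: eq_bigl.
Qed.

(** The correctness of the greedy algorithm: it produces an independent subset of
    [D] that no element of [D] extends, and augmentation forbids a larger one. *)
Lemma maximal_indep_card A D : A \in indep M -> A \subset D ->
    (forall x, x \in D -> x \notin A -> x |: A \notin indep M) ->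
  #|A| = rank D.
Proof.
move=> iA sAD maxA; apply/eqP; rewrite eqn_leq leq_rank //= leqNgt.
have [B [iB sBD <-]] := rank_attained D.
apply/negP => /(indep_aug iA iB)[x /setDP[xB xA] ixA].
by have := maxA x (subsetP sBD x xB) xA; rewrite ixA.
Qed.

Lemma extend_indep A D : A \in indep M -> A \subset D ->
  exists B, [/\ A \subset B, B \subset D, B \in indep M & #|B| = rank D].
Proof.
move=> iA sAD.
have [|B /maxsetP[/andP[iB sBD] maxB] sAB] :=
  @maxset_exists _ (fun B => (B \in indep M) && (B \subset D)) A.
  by rewrite iA.
exists B; split=> //; apply: maximal_indep_card => // x xD xB.
apply/negP => ixB; move/negP: xB; apply.
by rewrite -(maxB (x |: B)) ?setU11 ?subsetUr // ixB subUset sub1set xD.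
Qed.

(** Rephrases inclusion-maximality by the two tests that the programs can carry
    out: an oracle call and a comparison of greedily computed ranks. *)
Lemma mem_bases B : (B \in bases M) = (B \in indep M) && (rk M <= rank B).
Proof.
rewrite inE; apply/maxsetP/andP => [[iB maxB]|[iB rkB]]; split=> //.
  have [C [sBC _ iC cardC]] := extend_indep iB (subsetT B).
  by rewrite -(maxB C iC sBC) rank_indep // cardC rankT.
move=> C iC sBC; apply/esym/eqP; rewrite eqEcard sBC.
rewrite rank_indep // in rkB.
by apply: leq_trans rkB; rewrite -rankT leq_rank ?subsetT.
Qed.

Lemma bases_indep B : B \in bases M -> B \in indep M.
Proof. by rewrite mem_bases => /andP[]. Qed.

Lemma card_base B : B \in bases M -> #|B| = rk M.
Proof.
rewrite mem_bases => /andP[iB]; rewrite -(rank_indep iB) => le.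
by apply/eqP; rewrite eqn_leq rank_leq_rk.
Qed.

Lemma indep_leq_rk A : A \in indep M -> #|A| <= rk M.
Proof. by move=> iA; rewrite -rankT leq_rank ?subsetT. Qed.

End Rank.

Section Dual.
Variables (T : finType) (M : matroid T).
Implicit Types A B D S : {set T}.

(** The complement of [S] contains a base of [M]; stated with ranks because this is
    how the simulated oracle decides it. *)
Definition coindep := [set S | rk M <= rank M (~: S)].

Lemma coindep0 : set0 \in coindep.
Proof. by rewrite inE setC0 rankT. Qed.

Lemma coindepP S :
  reflect (exists B, [/\ B \in indep M, #|B| = rk M & [disjoint B & S]])
    (S \in coindep).
Proof.
rewrite inE; apply: (iffP idP) => [leS|[B [iB <- dBS]]].
  have [B [iB sBS cB]] := rank_attained M (~: S).
  exists B; split=> //; last by rewrite -[S]setCK -subsets_disjoint.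
  by apply/eqP; rewrite cB eqn_leq rank_leq_rk.
by rewrite leq_rank // subsets_disjoint setCK.
Qed.

Lemma coindepS A B : A \subset B -> B \in coindep -> A \in coindep.
Proof.
move=> sAB /coindepP[C [iC cC dC]]; apply/coindepP.
by exists C; split=> //; apply: disjointWr dC.
Qed.

(** Take a base [D] of [M] avoiding [B] and extend [D :\: A] to a base [C] that
    avoids [A].  If [C] contained all of [B :\: A], it would have at least
    [#|D :\: A| + #|B :\: A|] elements; but [D] loses at most [#|A :\: B|] elements
    when [A] is removed, so this exceeds [#|D|].  Hence some element of [B :\: A]
    can be added to [A] while [C] still avoids the result. *)
Lemma coindep_aug A B : A \in coindep -> B \in coindep -> #|A| < #|B| ->
  exists2 x, x \in B :\: A & x |: A \in coindep.
Proof.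
rewrite inE => spA /coindepP[D [iD cD dDB]] ltAB.
have iDA : D :\: A \in indep M := indepS (subsetDl D A) iD.
have [|C [sDC sCA iC cC]] := extend_indep iDA (D := ~: A).
  by apply/subsetP => x; rewrite !inE => /andP[].
have {}cC : #|C| = rk M by apply/eqP; rewrite cC eqn_leq rank_leq_rk.
have [/subsetP sBAC|/subsetPn[x xBA xC]] := boolP (B :\: A \subset C); last first.
  exists x => //; apply/coindepP; exists C; split=> //.
  by rewrite disjoints_subset setCU subsetI sCA andbT subsetC sub1set inE.
exfalso.
have dDA : [disjoint D :\: A & B :\: A].
  by apply: disjointWl (subsetDl _ _) _; apply: disjointWr (subsetDl _ _) _.
have le1 : #|D :\: A| + #|B :\: A| <= #|C|.
  rewrite -cardsUI (disjoint_setI0 dDA) cards0 addn0.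
  by apply/subset_leq_card; rewrite subUset sDC; apply/subsetP.
have le2 : #|D :&: A| <= #|A :\: B|.
  apply/subset_leq_card/subsetP => x /setIP[xD xA].
  by rewrite inE xA (disjointFr dDB xD).
have := cardsID A D; have := cardsID A B; have := cardsID B A.
rewrite (setIC B A) => h1 h2 h3.
lia.
Qed.

Definition dual := Matroid coindep0 coindepS coindep_aug.

Lemma bases_dual B : (~: B \in bases dual) = (B \in bases M).
Proof.
rewrite [RHS]mem_bases inE; apply/maxsetP/andP => [[]|[iB spB]].
  rewrite /= inE setCK => spB maxB.
  have [C [iC sCB cC]] := rank_attained M B.
  suff -> : B = C by rewrite iC rank_indep // cC.
  apply: setC_inj; apply/esym/maxB; last by rewrite setCS.
  by rewrite inE setCK rank_indep // cC.
split=> [|C]; first by rewrite inE setCK.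
rewrite inE => spC sBC; apply/setC_inj/eqP; rewrite setCK eqEcard.
rewrite -[B]setCK setCS sBC /= setCK.
rewrite -(rank_indep iB); apply: leq_trans (rank_leq_rk _ _) _.
exact: leq_trans spC (rank_leq_card _ _).
Qed.

End Dual.

(** * Two copies of the ground set *)

Section Parts.
Variable n : nat.
Implicit Types S A B : {set 'I_(n + n)}.

Definition lpart S : {set 'I_n} := [set i | lshift n i \in S].
Definition rpart S : {set 'I_n} := [set i | rshift n i \in S].
Definition glue (X Y : {set 'I_n}) : {set 'I_(n + n)} :=
  [set e | match split e with inl i => i \in X | inr i => i \in Y end].

Lemma lpart_glue X Y : lpart (glue X Y) = X.
Proof. by apply/setP => i; rewrite !inE (unsplitK (inl _ i)). Qed.

Lemma rpart_glue X Y : rpart (glue X Y) = Y.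
Proof. by apply/setP => i; rewrite !inE (unsplitK (inr _ i)). Qed.

Lemma sum_parts (V : nmodType) (F : 'I_(n + n) -> V) S :
  (\sum_(e in S) F e =
   \sum_(i in lpart S) F (lshift n i) + \sum_(i in rpart S) F (rshift n i))%R.
Proof.
rewrite big_mkcond big_split_ord /=; congr (_ + _)%R;
  by rewrite [RHS]big_mkcond; apply: eq_bigr => i _; rewrite inE.
Qed.

Lemma card_parts S : #|S| = #|lpart S| + #|rpart S|.
Proof. by rewrite -!sum1_card (sum_parts (fun=> 1%N)). Qed.

Lemma lpartS A B : A \subset B -> lpart A \subset lpart B.
Proof. by move/subsetP=> sAB; apply/subsetP => i; rewrite !inE => /sAB. Qed.

Lemma rpartS A B : A \subset B -> rpart A \subset rpart B.
Proof. by move/subsetP=> sAB; apply/subsetP => i; rewrite !inE => /sAB. Qed.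

Lemma lpart0 : lpart set0 = set0.
Proof. by apply/setP => i; rewrite !inE. Qed.

Lemma rpart0 : rpart set0 = set0.
Proof. by apply/setP => i; rewrite !inE. Qed.

Lemma lpartU1l i S : lpart (lshift n i |: S) = i |: lpart S.
Proof. by apply/setP => j; rewrite !inE eq_lshift. Qed.

Lemma rpartU1l i S : rpart (lshift n i |: S) = rpart S.
Proof. by apply/setP => j; rewrite !inE eq_rlshift. Qed.

Lemma lpartU1r i S : lpart (rshift n i |: S) = lpart S.
Proof. by apply/setP => j; rewrite !inE eq_lrshift. Qed.

Lemma rpartU1r i S : rpart (rshift n i |: S) = i |: rpart S.
Proof. by apply/setP => j; rewrite !inE eq_rshift. Qed.

Section DirectSum.
Variables N1 N2 : matroid 'I_n.

Definition sum_indep :=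
  [set S | (lpart S \in indep N1) && (rpart S \in indep N2)].

Lemma sum_indep0 : set0 \in sum_indep.
Proof. by rewrite inE lpart0 rpart0 !indep0. Qed.

Lemma sum_indepS A B : A \subset B -> B \in sum_indep -> A \in sum_indep.
Proof.
rewrite !inE => sAB /andP[iBl iBr].
by rewrite (indepS (lpartS sAB) iBl) (indepS (rpartS sAB) iBr).
Qed.

Lemma sum_indep_aug A B : A \in sum_indep -> B \in sum_indep -> #|A| < #|B| ->
  exists2 x, x \in B :\: A & x |: A \in sum_indep.
Proof.
rewrite !inE => /andP[iAl iAr] /andP[iBl iBr]; rewrite !card_parts => ltAB.
have [ltl|gel] := ltnP #|lpart A| #|lpart B|.
  have [i] := indep_aug iAl iBl ltl; rewrite !inE => iBA iA.
  by exists (lshift n i); rewrite !inE // lpartU1l rpartU1l iA.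
have [|i] := indep_aug iAr iBr; first by lia.
rewrite !inE => iBA iA.
by exists (rshift n i); rewrite !inE // lpartU1r rpartU1r iAl.
Qed.

Definition direct_sum := Matroid sum_indep0 sum_indepS sum_indep_aug.

End DirectSum.

Section FewPairs.
Variable k : nat.

Definition few_pairs := [set S | #|lpart S :&: rpart S| <= k].

Lemma few_pairs0 : set0 \in few_pairs.
Proof. by rewrite inE lpart0 set0I cards0. Qed.

Lemma few_pairsS A B : A \subset B -> B \in few_pairs -> A \in few_pairs.
Proof.
rewrite !inE => sAB; apply: leq_trans; apply: subset_leq_card.
by rewrite setISS ?lpartS ?rpartS.
Qed.

(** If nothing in [B] augments [A], then [A] already has exactly [k] pairs, since one
    new element completes at most one pair; and every element of which [B] contains
    a copy already has a copy in [A], since otherwise that copy would complete no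
    pair.  The size of a set is the number of elements that it touches plus its
    number of pairs, so [B] is not larger than [A]. *)
Lemma few_pairs_aug A B : A \in few_pairs -> B \in few_pairs -> #|A| < #|B| ->
  exists2 x, x \in B :\: A & x |: A \in few_pairs.
Proof.
move=> fA fB ltAB; apply/exists_inP; apply: contraT => /exists_inPn noaug.
(* [lpart S :|: rpart S] is the set of elements that [S] touches. *)
have supp : lpart B :|: rpart B \subset lpart A :|: rpart A.
  apply/subsetP => i; rewrite !inE; apply: contraTT; rewrite !negb_or.
  case/andP=> nl nr; apply/andP; split; apply/negP => iB.
    have /noaug/negP[] : lshift n i \in B :\: A by rewrite inE nl iB.
    rewrite inE lpartU1l rpartU1l setIUl.
    rewrite (_ : [set i] :&: _ = set0) ?set0U; first by rewrite inE in fA.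
    by apply/setP => j; rewrite !inE; case: eqP => // ->; rewrite (negPf nr).
  have /noaug/negP[] : rshift n i \in B :\: A by rewrite inE nr iB.
  rewrite inE lpartU1r rpartU1r setIUr.
  rewrite (_ : _ :&: [set i] = set0) ?set0U; first by rewrite inE in fA.
  by apply/setP => j; rewrite !inE andbC; case: eqP => // ->; rewrite (negPf nl).
have full : k <= #|lpart A :&: rpart A|.
  have [x xBA] : exists x, x \in B :\: A.
    by apply/set0Pn; rewrite setD_eq0; apply/negP => /subset_leq_card; lia.
  have := noaug x xBA; rewrite inE -ltnNge => gtk.
  rewrite -ltnS; apply: leq_trans gtk _.
  case: (split_ordP x) => i ->.
    rewrite lpartU1l rpartU1l setIUl (leq_trans (leq_card_setU _ _)) //.
    by rewrite -add1n leq_add2r -[1](cards1 i) subset_leq_card ?subsetIl.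
  rewrite lpartU1r rpartU1r setIUr (leq_trans (leq_card_setU _ _)) //.
  by rewrite -add1n leq_add2r -[1](cards1 i) subset_leq_card ?subsetIr.
have := subset_leq_card supp; rewrite !cardsU.
have := subset_leq_card (subsetIl (lpart A) (rpart A)).
have := subset_leq_card (subsetIl (lpart B) (rpart B)).
move: fA fB ltAB; rewrite !inE !card_parts.
lia.
Qed.

End FewPairs.
End Parts.
Definition few_pairs_matroid n k :=
  Matroid (@few_pairs0 n k) (@few_pairsS n k) (@few_pairs_aug n k).

(** * The weighted matroid intersection instance *)

Section Optimum.
Variables (R : realType) (n : nat) (N1 N2 : matroid 'I_n) (k : nat).
Variables (d1 d2 : 'I_n -> R).
Implicit Types (S A : {set 'I_(n + n)}) (X Y : {set 'I_n}).

Definition big_cost : R := (1 + \sum_i (`|d1 i| + `|d2 i|))%R.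

Definition big_weight (e : 'I_(n + n)) : R :=
  match split e with
  | inl i => (big_cost - d1 i)%R
  | inr i => (big_cost - d2 i)%R
  end.

Definition wmi_of := WmiInstance (direct_sum N1 N2) (few_pairs_matroid n k)
  big_weight.

Lemma big_weight_l i : big_weight (lshift n i) = (big_cost - d1 i)%R.
Proof. by rewrite /big_weight (unsplitK (inl _ i)). Qed.

Lemma big_weight_r i : big_weight (rshift n i) = (big_cost - d2 i)%R.
Proof. by rewrite /big_weight (unsplitK (inr _ i)). Qed.

Lemma setcost_big_weight S :
  setcost big_weight S =
  (big_cost *+ #|S| - (setcost d1 (lpart S) + setcost d2 (rpart S)))%R.
Proof.
rewrite /setcost sum_parts card_parts mulrnDr opprD addrACA.
congr (_ + _)%R; rewrite -sumr_const -sumrB; apply: eq_bigr => i _.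
  exact: big_weight_l.
exact: big_weight_r.
Qed.

(** Each element contributes [c i], [- c i] or [0] to the difference. *)
Lemma setcost_diff (c : 'I_n -> R) X Y :
  (setcost c X - setcost c Y <= \sum_i `|c i|)%R.
Proof.
rewrite /setcost big_mkcond [X in (_ - X)%R]big_mkcond -sumrB /=.
apply: ler_sum => i _; have := ler_norm (c i); have := lerNnormlW (lexx `|c i|%R).
by case: (i \in X); case: (i \in Y) => /=; lra.
Qed.

(** Costs of two sets differ by at most the sum of all absolute values, which is
    less than what one additional element gains. *)
Lemma big_weight_mono S S' : #|S| < #|S'| ->
  (setcost big_weight S < setcost big_weight S')%R.
Proof.
move=> lt; rewrite !setcost_big_weight.
have := setcost_diff d1 (lpart S') (lpart S).
have := setcost_diff d2 (rpart S') (rpart S).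
have big_ge0 : (0 <= big_cost)%R.
  by rewrite addr_ge0 // sumr_ge0 // => i _; rewrite addr_ge0.
have : (big_cost *+ #|S| + big_cost <= big_cost *+ #|S'|)%R.
  by rewrite -mulrSr ler_wpMn2l.
have : (big_cost = 1 + (\sum_i `|d1 i| + \sum_i `|d2 i|))%R.
  by rewrite /big_cost big_split.
move: (\sum_i `|d1 i|)%R (\sum_i `|d2 i|)%R => x y; lra.
Qed.

(** The mere existence of a feasible pair [(X, Y)] of bases forces the parts of an
    optimal set [A] to be bases: [A] has at least the cardinality of the glued pair,
    and its two independent parts cannot be larger than bases. *)
Lemma wmi_of_optimal A X Y : wmi_optimal wmi_of A ->
    X \in bases N1 -> Y \in bases N2 -> #|X :&: Y| <= k ->
  [/\ lpart A \in bases N1, rpart A \in bases N2 &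
      (setcost d1 (lpart A) + setcost d2 (rpart A) <=
       setcost d1 X + setcost d2 Y)%R].
Proof.
move=> [feasA optA] bX bY leXY.
have /andP[iAl iAr] : (lpart A \in indep N1) && (rpart A \in indep N2).
  by move: feasA; rewrite /wmi_feasible /= !inE => /andP[].
have iX := bases_indep bX; have iY := bases_indep bY.
have leA : (setcost big_weight (glue X Y) <= setcost big_weight A)%R.
  by apply: optA; rewrite /wmi_feasible /= !inE !lpart_glue !rpart_glue iX iY.
have cardA : #|glue X Y| <= #|A|.
  by rewrite leqNgt; apply: contraL leA => /big_weight_mono; rewrite -ltNge.
(* Each part of [A] is no larger than the corresponding base, hence equality. *)
have {}cardA : (#|lpart A| = #|X|) /\ (#|rpart A| = #|Y|).
  have := indep_leq_rk iAl; have := indep_leq_rk iAr.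
  rewrite -(card_base bX) -(card_base bY).
  by move: cardA; rewrite !card_parts lpart_glue rpart_glue; lia.
case: cardA => cAl cAr.
split; first by rewrite mem_bases iAl rank_indep // cAl (card_base bX) /=.
  by rewrite mem_bases iAr rank_indep // cAr (card_base bY) /=.
move: leA; rewrite !setcost_big_weight lpart_glue rpart_glue.
by rewrite !card_parts lpart_glue rpart_glue cAl cAr lerD2l lerN2.
Qed.

End Optimum.

Section Reduction.
Variables (R : realType) (delta : bool) (I : instance R).
Local Notation n := (isize I).
Implicit Types X Y Z : {set 'I_n}.

Definition flip (T : finType) (Z : {set T}) := if delta then ~: Z else Z.
Definition cmp_of : rel nat := if delta then P_ge else P_le.
Definition second_matroid := if delta then dual (mat2 I) else mat2 I.
Definition pair_bound := if delta then rk (mat1 I) - bound I else bound I.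
Definition second_cost i : R := if delta then (- cost2 i)%R else @cost2 R I i.
Definition reduced : wmi_instance R :=
  wmi_of (mat1 I) second_matroid pair_bound (@cost1 R I) second_cost.

Lemma flipK T : involutive (@flip T).
Proof. by move=> Z; rewrite /flip; case: delta => //; exact: setCK. Qed.

Lemma bases_second Z : (flip Z \in bases second_matroid) = (Z \in bases (mat2 I)).
Proof. by rewrite /flip /second_matroid; case: delta => //; rewrite bases_dual. Qed.

(** In the dualized case, [X :&: ~: Z] and [X :&: Z] split the [rk M1] elements of
    the base [X]. *)
Lemma pair_bound_cmp X Z : X \in bases (mat1 I) ->
  (#|X :&: flip Z| <= pair_bound) = cmp_of #|X :&: Z| (bound I).
Proof.
rewrite /flip /pair_bound /cmp_of; case: delta => // bX.
rewrite -setDE /P_ge; have := cardsID Z X; rewrite (card_base bX).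
have := bound_le I; lia.
Qed.

(** Complementing [Z] and negating its cost changes the objective only by the cost of
    the whole ground set, so minimizers correspond. *)
Lemma second_cost_flip Z :
  (setcost second_cost (flip Z) =
   setcost (@cost2 R I) Z - (if delta then setcost (@cost2 R I) setT else 0))%R.
Proof.
rewrite /setcost /flip /second_cost; case: delta; last by rewrite subr0.
rewrite sumrN [X in (_ = _ - X)%R](big_setID Z) /= setTI setTD.
by rewrite opprD addrA subrr sub0r.
Qed.

(** The disjunction between an optimal solution and infeasibility is decided by
    whether the two parts of [A] are bases, a test within reach of the oracles. *)
Lemma reduced_correct (A : {set 'I_(n + n)}) :
    wmi_optimal reduced A ->
  let X := lpart A in let Y := flip (rpart A) in
  if (X \in bases (mat1 I)) && (Y \in bases (mat2 I))
  then optimal cmp_of I X Y else infeasible cmp_of I.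
Proof.
move=> optA X Y.
have better X' Y' : feasible cmp_of I X' Y' ->
  [/\ X \in bases (mat1 I), Y \in bases (mat2 I) &
      (objective I X Y <= objective I X' Y')%R].
  case=> bX' bY' cmpXY.
  have [||bX bY le] := wmi_of_optimal (Y := flip Y') optA bX'.
  - by rewrite bases_second.
  - by rewrite pair_bound_cmp.
  split=> //; first by rewrite -bases_second flipK.
  by move: le; rewrite -[rpart A]flipK -/Y !second_cost_flip !addrA lerD2r.
case: ifP => [/andP[bX bY]|nb]; last first.
  by move=> X' Y' /better[bX bY _]; rewrite bX bY in nb.
split; last by move=> X' Y' /better[].
split=> //; rewrite -pair_bound_cmp // flipK.
by case: optA; rewrite /wmi_feasible inE => /andP[_]; rewrite /= inE.
Qed.

End Reduction.

(** * Reasoning about programs *)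

(* The first three arrays are those of the input.  Notations rather than definitions,
   so that comparing two array numbers is a computation. *)
Local Notation aSize := 0 (only parsing).
Local Notation aBound := 1 (only parsing).
Local Notation aSol := 2 (only parsing).
Local Notation aSecond := 3 (only parsing).
Local Notation aGreedy := 4 (only parsing).
Local Notation aRank := 5 (only parsing).
Local Notation aCtr := 6 (only parsing).
Local Notation aAns := 7 (only parsing).
Local Notation aGap := 8 (only parsing).
Local Notation aIndep := 9 (only parsing).
Local Notation aBase1 := 10 (only parsing).
Local Notation aBase2 := 11 (only parsing).

Local Notation rank_scratch := [:: aGreedy; aRank; aCtr; aAns] (only parsing).

Definition scalar a := NGet a (NConst 0).
Definition idx := scalar aCtr.
Definition set_scalar a e := NSet a (NConst 0) e.

(** All loops share one counter: they are never nested. *)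
Definition For body :=
  Seq (set_scalar aCtr (NConst 0))
    (While (NLe (NAdd idx (NConst 1)) (scalar aSize))
      (Seq body (set_scalar aCtr (NAdd idx (NConst 1))))).

Section Runs.
Variables (R : realType) (O : bool -> (nat -> nat) -> bool).
Implicit Types (s : store R) (Q : store R -> Prop).

(** A total-correctness triple with a bound on the number of steps; it generalizes
    [runs_within] to arbitrary initial memories. *)
Definition runs c s T Q := exists t s', [/\ exec O c s t s', t <= T & Q s'].

Definition setn s a i v : store R := Store (upd (nmem s) a i v) (rmem s).
Definition setr s a i v : store R := Store (nmem s) (upd (rmem s) a i v).

Lemma runs_le c s T T' Q : runs c s T Q -> T <= T' -> runs c s T' Q.
Proof. by case=> t [s' [ex le q]] le'; exists t, s'; split=> //; apply: leq_trans le'. Qed.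

Lemma runs_skip s Q : Q s -> runs Skip s 1 Q.
Proof. by exists 1, s; split=> //; apply: ExecSkip. Qed.

Lemma runs_nset a i e s Q :
  Q (setn s a (neval s i) (neval s e)) -> runs (NSet a i e) s 1 Q.
Proof. by exists 1; eexists; split; [apply: ExecNSet| |]. Qed.

Lemma runs_rset a i e s Q :
  Q (setr s a (neval s i) (reval s e)) -> runs (RSet a i e) s 1 Q.
Proof. by exists 1; eexists; split; [apply: ExecRSet| |]. Qed.

Lemma runs_query o q a s Q :
  Q (setn s a 0 (O o (nmem s q))) -> runs (Query o q a) s 1 Q.
Proof. by exists 1; eexists; split; [apply: ExecQuery| |]. Qed.

Lemma runs_seq c1 c2 s T1 T2 Q1 Q : runs c1 s T1 Q1 ->
  (forall s1, Q1 s1 -> runs c2 s1 T2 Q) -> runs (Seq c1 c2) s (T1 + T2) Q.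
Proof.
case=> t1 [s1 [ex1 le1 q1]] /(_ s1 q1) [t2 [s2 [ex2 le2 q2]]].
by exists (t1 + t2), s2; split; [apply: ExecSeq ex1 ex2|apply: leq_add|].
Qed.

Lemma runs_seqk c1 c2 s T1 T2 Q :
  runs c1 s T1 (fun s1 => runs c2 s1 T2 Q) -> runs (Seq c1 c2) s (T1 + T2) Q.
Proof. by move=> /runs_seq; apply. Qed.

Lemma runs_if b c1 c2 s T Q :
    (beval s b -> runs c1 s T Q) -> (~~ beval s b -> runs c2 s T Q) ->
  runs (If b c1 c2) s T.+1 Q.
Proof.
move=> r1 r2.
have [t [s' [ex le q]]] : runs (if beval s b then c1 else c2) s T Q.
  by case: ifP => [/r1|/negbT/r2].
by exists t.+1, s'; split=> //; apply: ExecIf.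
Qed.

(** A round costs two steps more than its body, for the test and for the update of the
    counter; two further steps are the initialization and the failing test. *)
Lemma runs_for n T body (Inv : nat -> store R -> Prop) s :
    nmem s aSize 0 = n -> Inv 0 (setn s aCtr 0 0) ->
    (forall i s1, i < n -> nmem s1 aCtr 0 = i -> nmem s1 aSize 0 = n ->
       Inv i s1 ->
     runs body s1 T (fun s2 => [/\ nmem s2 aCtr 0 = i, nmem s2 aSize 0 = n &
                                   Inv i.+1 (setn s2 aCtr 0 i.+1)])) ->
  runs (For body) s (n * T.+2 + 2)
    (fun s' => nmem s' aSize 0 = n /\ Inv n s').
Proof.
move=> sn inv0 step.
pose W := While (NLe (NAdd idx (NConst 1)) (scalar aSize))
      (Seq body (set_scalar aCtr (NAdd idx (NConst 1)))).
have loop m i s1 : m + i = n -> nmem s1 aSize 0 = n -> nmem s1 aCtr 0 = i ->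
  Inv i s1 -> runs W s1 (m * T.+2 + 1) (fun s' => nmem s' aSize 0 = n /\ Inv n s').
  elim: m i s1 => [|m IH] i s1 mi sn1 ctr1 inv1.
    exists 1, s1; split=> //; last by split=> //; rewrite -mi.
    by apply: ExecWhileFalse; rewrite /= sn1 ctr1; lia.
  have [|t [s2 [ex le [ctr2 sn2 inv2]]]] := step i s1 _ ctr1 sn1 inv1; first by lia.
  have [|//|//|t' [s3 [ex' le' q]]] := IH i.+1 _ _ _ _ inv2; first by lia.
  exists (t + 1 + t').+1, s3; split=> //; last by move: le le'; nia.
  apply: ExecWhileTrue ex'; first by rewrite /= sn1 ctr1; lia.
  apply: ExecSeq ex _; rewrite -(addn1 i) -ctr2; exact: ExecNSet.
apply: (@runs_le _ _ (1 + (n * T.+2 + 1))); last by lia.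
apply: (runs_seq (Q1 := fun s' => s' = setn s aCtr 0 0)).
  exact: runs_nset.
by move=> _ ->; apply: loop => //; exact: addn0.
Qed.

(** Frame condition for the programs on sets; the real arrays are left out because
    only the construction of the weights touches them. *)
Definition agree_off (W : seq nat) s s' :=
  forall a j, a \notin W -> nmem s' a j = nmem s a j.

Lemma agree_off_refl W s : agree_off W s s.
Proof. by []. Qed.

Lemma agree_off_setn W s s' a i v : a \in W -> agree_off W s s' ->
  agree_off W s (setn s' a i v).
Proof.
move=> aW sm b j bW; rewrite /= /upd.
by have [eba|_] := eqVneq b a; [rewrite eba aW in bW|rewrite /= sm].
Qed.

Lemma agree_off_trans W W' s s' s'' : {subset W <= W'} ->
  agree_off W' s s' -> agree_off W s' s'' -> agree_off W' s s''.
Proof. by move=> sub sm sm' a j aW; rewrite sm' ?sm //; apply: contra aW => /sub. Qed.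

Lemma updE (V : Type) (mem : nat -> nat -> V) a i v j :
  upd mem a i v a j = if j == i then v else mem a j.
Proof. by rewrite /upd eqxx. Qed.

(** Abstracts an expression in the body of a loop to a function of the counter, which
    is possible when the loop modifies only [W]. *)
Definition reads n W s e f :=
  forall s' j, j < n -> agree_off W s s' -> nmem s' aCtr 0 = j -> neval s' e = f j.

Definition Fill a e := For (NSet a idx e).

Lemma runs_fill n W a e f s : a \in W -> aCtr \in W -> aSize \notin W ->
    a != aCtr -> nmem s aSize 0 = n -> reads n W s e f ->
  runs (Fill a e) s (n * 3 + 2) (fun s' =>
    agree_off W s s' /\ forall j, j < n -> nmem s' a j = f j).
Proof.
move=> aW cW zW ac sn rd.
have [||t [s' [ex le [_ q]]]] := @runs_for n 1 (NSet a idx e)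
  (fun i s' => agree_off W s s' /\ forall j, j < i -> nmem s' a j = f j) s sn; last first.
- by exists t, s'.
- move=> i s1 lt ctr1 sn1 [sm1 eq1]; apply: runs_nset.
  split; first by rewrite /= /upd eq_sym (negPf ac).
    by rewrite /= /upd; case: eqVneq => // az; rewrite az aW in zW.
  rewrite /= ctr1; split; first exact: (agree_off_setn _ _ cW (agree_off_setn _ _ aW sm1)).
  move=> j; rewrite /= ltnS leq_eqVlt {1}/upd (negPf ac) /= updE.
  by case: eqVneq => [-> _|_ /eq1]; first exact: rd.
by split=> //; apply: agree_off_setn.
Qed.

End Runs.

Section Greedy.
Variables (R : realType) (I : instance R).
Local Notation n := (isize I).
Implicit Types s : store R.

Definition oracle_matroid o := if o then mat2 I else mat1 I.

Lemma decode_set_ext u v : (forall j, j < n -> u j = v j) ->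
  decode_set n u = decode_set n v.
Proof. by move=> uv; apply/setP => j; rewrite !inE uv. Qed.

Lemma oracle_ofE o v : oracle_of I o v = (decode_set n v \in indep (oracle_matroid o)).
Proof. by case: o. Qed.

(** The array [aGreedy] holds the independent set built so far.  The next element is
    inserted tentatively and removed again if the oracle rejects the result. *)
Definition GreedyStep o e :=
  If (NLe (NConst 1) e)
    (Seq (NSet aGreedy idx (NConst 1))
    (Seq (Query o aGreedy aAns)
      (If (NLe (NConst 1) (scalar aAns))
        (set_scalar aRank (NAdd (scalar aRank) (NConst 1)))
        (NSet aGreedy idx (NConst 0)))))
    Skip.

Definition Rank o e :=
  Seq (Fill aGreedy (NConst 0))
  (Seq (set_scalar aRank (NConst 0))
    (For (GreedyStep o e))).

(** The last clause is the maximality that [maximal_indep_card] needs once all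
    elements have been treated. *)
Definition greedy_inv o f i s :=
  let B := decode_set n (nmem s aGreedy) in
  [/\ B \in indep (oracle_matroid o),
      B \subset [set x : 'I_n | (x < i) && (f x != 0)],
      nmem s aRank 0 = #|B| &
      forall x : 'I_n, x < i -> f x != 0 -> x \notin B ->
        x |: B \notin indep (oracle_matroid o)].

Lemma decode_set1 mem a i : forall lt : i < n,
  decode_set n (upd mem a i 1 a) = Ordinal lt |: decode_set n (mem a).
Proof.
move=> lt; apply/setP => x; rewrite !inE updE.
by rewrite -val_eqE /=; case: ifP.
Qed.

(** A rejected element stays rejected, because the current set only grows. *)
Lemma greedy_step o e f i s s0 : i < n -> nmem s aCtr 0 = i ->
    nmem s aSize 0 = n -> agree_off rank_scratch s0 s -> neval s e = f i ->
    greedy_inv o f i s ->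
  runs (oracle_of I) (GreedyStep o e) s 5 (fun s' =>
    [/\ nmem s' aCtr 0 = i, nmem s' aSize 0 = n, agree_off rank_scratch s0 s' &
        greedy_inv o f i.+1 s']).
Proof.
move=> lt ctr sn sm ef [iB sB rB mB].
set B := decode_set n _ in iB sB rB mB.
have iNB : Ordinal lt \notin B.
  by apply/negP => /(subsetP sB); rewrite inE /= ltnn.
have ltS (x : 'I_n) : x < i.+1 -> x != Ordinal lt -> x < i.
  by rewrite ltnS leq_eqVlt => /orP[/eqP xi|//]; rewrite -val_eqE /= xi eqxx.
have sBS : B \subset [set x : 'I_n | (x < i.+1) && (f x != 0)].
  by apply: subset_trans sB _; apply/subsetP => x; rewrite !inE ltnS => /andP[/ltnW -> ->].
apply: runs_if => /=; rewrite ef => fi; last first.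
  apply: (runs_le (T := 1)) => //; apply: runs_skip; split=> //; split=> //.
  move=> x ltx fx; apply: mB => //; apply: ltS => //.
  by apply: contraNneq fi => xi; rewrite lt0n; rewrite xi in fx.
apply: (runs_le (T := 1 + (1 + 2))) => //.
apply: runs_seqk; apply: runs_nset; apply: runs_seqk; apply: runs_query.
rewrite oracle_ofE /= ctr (decode_set1 _ _ lt) -/B.
set s1 := setn _ _ _ _.
have sm1 : agree_off rank_scratch s0 s1 by do 2! apply: agree_off_setn => //.
have dec1 : decode_set n (nmem s1 aGreedy) = Ordinal lt |: B by exact: decode_set1.
apply: runs_if => /=; rewrite lt0n eqb0 ?negbK => iN.
  apply: runs_nset; split=> //; first exact: agree_off_setn.
  rewrite /greedy_inv /= dec1; split=> //.
  - by rewrite subUset sub1set sBS andbT inE /= ltnSn -lt0n.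
  - by rewrite /upd /= rB cardsU1 iNB addn1 add1n.
  move=> x ltx fx; rewrite in_setU1 negb_or => /andP[xi xB].
  have := mB x (ltS x ltx xi) fx xB; apply: contra.
  by apply: indepS; rewrite setUCA subsetUr.
have ctr1 : neval s1 idx = i by exact: ctr.
apply: runs_nset; rewrite ctr1; split=> //; first exact: agree_off_setn.
have dec2 : decode_set n (nmem (setn s1 aGreedy i 0) aGreedy) = B.
  apply/setP => x; rewrite inE /= updE -[x == i :> nat]/(x == Ordinal lt).
  have [->|xi] := eqVneq x (Ordinal lt); first by rewrite (negPf iNB).
  by move/setP: dec1 => /(_ x); rewrite in_setU1 inE (negPf xi).
rewrite /greedy_inv dec2; split=> //.
move=> x ltx fx xB.
have [->//|xi] := eqVneq x (Ordinal lt).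
by apply: mB => //; apply: ltS.
Qed.

Lemma runs_rank o e f s : nmem s aSize 0 = n ->
    reads n rank_scratch s e f ->
  runs (oracle_of I) (Rank o e) s (n * 10 + 5) (fun s' =>
    agree_off rank_scratch s s' /\
    nmem s' aRank 0 = rank (oracle_matroid o) (decode_set n f)).
Proof.
move=> sn rd; apply: (runs_le (T := (n * 3 + 2) + (1 + (n * 7 + 2)))); last by lia.
apply: (runs_seq (@runs_fill _ _ n rank_scratch _ _ (fun=> 0) _ _ _ _ _ _ _)) => //.
move=> s1 [sm1 eq1]; apply: runs_seqk; apply: runs_nset => /=.
set s2 := setn _ _ _ _.
have sm2 : agree_off rank_scratch s s2 by apply: agree_off_setn.
have sn2 : nmem s2 aSize 0 = n by rewrite sm2.
have [||t [s' [ex le [_ [sm' inv']]]]] := @runs_for _ (oracle_of I) n 5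
    (GreedyStep o e) (fun i s' => agree_off rank_scratch s s' /\ greedy_inv o f i s')
    s2 sn2; last first.
- exists t, s'; split=> //; split=> //.
  case: inv' => iB sB -> mB; apply: maximal_indep_card => //.
    by apply: subset_trans sB _; apply/subsetP => x; rewrite !inE => /andP[].
  by move=> x; rewrite inE => fx; apply: mB.
- move=> i s3 lt ctr3 sn3 [sm3 inv3].
  have [|t [s4 [ex le [ctr4 sn4 sm4 inv4]]]] :=
    greedy_step (e := e) lt ctr3 sn3 sm3 _ inv3; first exact: rd.
  by exists t, s4; split=> //; split=> //; split=> //; apply: agree_off_setn.
split; first exact: agree_off_setn.
have dec0 : decode_set n (nmem (setn s2 aCtr 0 0) aGreedy) = set0.
  by apply/setP => x; rewrite !inE /= /upd /= eq1.
by rewrite /greedy_inv /= dec0 indep0 sub0set cards0; split.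
Qed.
End Greedy.

(** * The programs of the reduction *)

Definition gap_scratch := aGap :: rank_scratch.
(** The gap between the rank of the matroid and that of the set is zero iff the set
    contains a base. *)
Definition Gap o e :=
  Seq (Rank o e)
  (Seq (set_scalar aGap (scalar aRank))
  (Seq (Rank o (NConst 1))
    (set_scalar aGap (NSub (scalar aRank) (scalar aGap))))).

(** The truncated difference is 1 if the oracle answers 1 and the gap is 0, and 0
    otherwise, so that it tests for a base. *)
Definition Base o a r :=
  Seq (Gap o (NGet a idx))
  (Seq (Query o a aIndep)
    (set_scalar r (NSub (scalar aIndep) (scalar aGap)))).

(** Position [n + i] of a characteristic vector belongs to the second copy of [i]. *)
Definition second_elt := NGet aSol (NAdd (scalar aSize) idx).

Definition Second delta :=
  Fill aSecond (if delta then NSub (NConst 1) second_elt else second_elt).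

(* The Boolean connectives are again encoded by truncated subtraction. *)
Definition Sim1 (delta : bool) :=
  Seq (Second delta)
  (Seq (Query false aSol aIndep)
  (if delta then
     Seq (Gap true (NGet aSecond idx))
       (set_scalar 0 (NSub (scalar aIndep) (scalar aGap)))
   else
     Seq (Query true aSecond aAns)
       (set_scalar 0 (NSub (NAdd (scalar aIndep) (scalar aAns)) (NConst 1))))).

Definition CountStep :=
  If (BAnd (NLe (NConst 1) (NGet aSol idx)) (NLe (NConst 1) second_elt))
    (set_scalar aAns (NAdd (scalar aAns) (NConst 1)))
    Skip.

(** The final value [bound + 1 - count] is nonzero iff [count <= bound]. *)
Definition Sim2 (delta : bool) :=
  Seq (if delta then
         Seq (Rank false (NConst 1))
           (set_scalar aBound (NSub (scalar aRank) (scalar aBound)))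
       else Skip)
  (Seq (set_scalar aAns (NConst 0))
  (Seq (For CountStep)
    (set_scalar 0 (NSub (NAdd (scalar aBound) (NConst 1)) (scalar aAns))))).

(* The bases are recognized before arrays 1 and 2 are overwritten by the output. *)
Definition Extract delta :=
  Seq (Second delta)
  (Seq (Base false aSol aBase1)
  (Seq (Base true aSecond aBase2)
  (Seq (Fill 1 (NGet aSol idx))
  (Seq (Fill 2 (NGet aSecond idx))
    (set_scalar 0 (NSub (NAdd (scalar aBase1) (scalar aBase2)) (NConst 1))))))).

Definition rtotal := RGet 2 (NConst 0).
Definition AddAbs a :=
  If (RLe (RConst 0) (RGet a idx))
    (RSet 2 (NConst 0) (RAdd rtotal (RGet a idx)))
    (RSet 2 (NConst 0) (RSub rtotal (RGet a idx))).

(** The weights replace the first cost array in place: the weight of a second copy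
    goes beyond its end, and its cell [idx] is not read in any other round. *)
Definition WeightStep (delta : bool) :=
  Seq (RSet 0 (NAdd (scalar aSize) idx)
        (if delta then RAdd rtotal (RGet 1 idx) else RSub rtotal (RGet 1 idx)))
    (RSet 0 idx (RSub rtotal (RGet 0 idx))).

Definition Construct delta :=
  Seq (RSet 2 (NConst 0) (RConst 1))
  (Seq (For (Seq (AddAbs 0) (AddAbs 1)))
  (Seq (For (WeightStep delta))
    (set_scalar aSize (NAdd (scalar aSize) (scalar aSize))))).

Section Programs.
Variables (R : realType) (I : instance R).
Local Notation n := (isize I).
Local Notation O := (oracle_of I).
Local Notation dec := (decode_set n).
Implicit Types s : store R.

Lemma reads_sub W W' m s e f : {subset W <= W'} ->
  @reads R m W' s e f -> reads m W s e f.
Proof.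
move=> sub rd s' j lt sm; apply: rd => // a i aW.
by apply: sm; apply: contra aW => /sub.
Qed.

Lemma reads_array m W s a : a \notin W ->
  @reads R m W s (NGet a idx) (nmem s a).
Proof. by move=> aW s' j lt sm ctr; rewrite /= ctr sm. Qed.

Lemma dec_full : dec (fun=> 1) = setT.
Proof. by apply/setP => i; rewrite !inE. Qed.

Lemma runs_gap o e f s : nmem s aSize 0 = n -> reads n gap_scratch s e f ->
  runs O (Gap o e) s (n * 20 + 12) (fun s' => agree_off gap_scratch s s' /\
    nmem s' aGap 0 = rk (oracle_matroid I o) - rank (oracle_matroid I o) (dec f)).
Proof.
move=> sn rd.
have sub : {subset rank_scratch <= gap_scratch} by move=> x hx; rewrite inE hx orbT.
apply: (runs_le (T := (n * 10 + 5) + (1 + ((n * 10 + 5) + 1)))); last by lia.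
apply: runs_seq; first exact: runs_rank sn (reads_sub sub rd).
move=> s1 [sm1 r1]; apply: runs_seqk; apply: runs_nset.
set s2 := setn _ _ _ _.
have sm2 : agree_off gap_scratch s s2.
  by apply: agree_off_setn => //; apply: agree_off_trans sub (@agree_off_refl _ _ _) sm1.
apply: runs_seq.
  by apply: (@runs_rank _ _ o _ (fun=> 1)); rewrite ?sm2.
move=> s3 [sm3 r3]; apply: runs_nset; split.
  by apply: agree_off_setn => //; apply: agree_off_trans sub sm2 sm3.
by rewrite /= updE /= r3 dec_full rankT sm3 //= updE /= r1.
Qed.

Definition base_scratch r := [:: r, aIndep & gap_scratch].

Lemma runs_base o a r s : nmem s aSize 0 = n -> a \notin aIndep :: gap_scratch ->
  runs O (Base o a r) s (n * 20 + 14) (fun s' => agree_off (base_scratch r) s s' /\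
    nmem s' r 0 = (dec (nmem s a) \in bases (oracle_matroid I o))).
Proof.
move=> sn; rewrite inE negb_or => /andP[_ ag].
apply: (runs_le (T := (n * 20 + 12) + (1 + 1))); last by lia.
apply: runs_seq; first exact: runs_gap sn (reads_array ag).
move=> s1 [sm1 r1]; apply: runs_seqk; apply: runs_query; apply: runs_nset.
rewrite oracle_ofE (decode_set_ext (v := nmem s a)); last by move=> j _; apply: sm1.
split.
  apply: agree_off_setn; first by rewrite inE eqxx.
  apply: agree_off_setn; first by rewrite !inE eqxx orbT.
  apply: agree_off_trans sm1 => // x; rewrite !inE => h.
  by rewrite h !orbT.
rewrite /= updE /= updE /= {1}/upd /= r1 mem_bases -subn_eq0.
by case: (_ \in _); case: (rk _ - _).
Qed.

Lemma runs_second delta s : nmem s aSize 0 = n ->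
  runs O (Second delta) s (n * 3 + 2) (fun s' => agree_off [:: aSecond; aCtr] s s' /\
    dec (nmem s' aSecond) = flip delta (dec (fun j => nmem s aSol (n + j)))).
Proof.
move=> sn; pose f j := let v := nmem s aSol (n + j) in if delta then 1 - v else v.
have rd : reads n [:: aSecond; aCtr] s
    (if delta then NSub (NConst 1) second_elt else second_elt) f.
  by move=> s' j lt sm ctr; rewrite /f; case: (delta) => /=; rewrite ctr !sm //= sn.
have [t [s' [ex le [sm eqf]]]] :=
  @runs_fill _ O n [:: aSecond; aCtr] aSecond _ _ s isT isT isT isT sn rd.
exists t, s'; split=> //; split=> //; apply/setP => i.
rewrite /flip (decode_set_ext eqf) inE /f.
by case: (delta); rewrite !inE //; case: (nmem _ _ _).
Qed.

Variable A : {set 'I_(n + n)}.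

Lemma encode_setE (m : nat) (S : {set 'I_m}) (i : 'I_m) : encode_set S i = (i \in S).
Proof. by rewrite /encode_set valK. Qed.

Lemma dec_lpart : dec (encode_set A) = lpart A.
Proof. by apply/setP => i; rewrite !inE (encode_setE A (lshift n i)) eqb0 negbK. Qed.

Lemma dec_rpart : dec (fun j => encode_set A (n + j)) = rpart A.
Proof. by apply/setP => i; rewrite !inE (encode_setE A (rshift n i)) eqb0 negbK. Qed.

Let s0 := initial I (encode_set A).

Lemma runs_sim1 delta :
  runs O (Sim1 delta) s0 (100 * n + 100)
    (outputs_bool (A \in sum_indep (mat1 I) (second_matroid delta I))).
Proof.
apply: (runs_le (T := (n * 3 + 2) + (1 + (n * 20 + 13)))); last by lia.
apply: runs_seq; first exact: runs_second.
move=> s1 [sm1 eq1]; apply: runs_seqk; apply: runs_query.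
set s2 := setn _ _ _ _.
have sn2 : nmem s2 aSize 0 = n by rewrite /s2 /= /upd /= sm1.
have i2 : nmem s2 aIndep 0 = (lpart A \in indep (mat1 I)).
  rewrite /s2 /= updE oracle_ofE -dec_lpart /=.
  by rewrite (decode_set_ext (v := encode_set A)) // => j _; apply: sm1.
have {}eq1 : dec (nmem s1 aSecond) = flip delta (rpart A) by rewrite eq1 -dec_rpart.
rewrite /outputs_bool inE; move: eq1; rewrite /flip /second_matroid.
case: delta => eq1.
  apply: (runs_le (T := (n * 20 + 12) + 1)); last by lia.
  apply: runs_seq.
    exact: (runs_gap true sn2 (reads_array _)).
  move=> s3 [sm3 r3]; apply: runs_nset; rewrite /= updE /= r3 sm3 // i2.
  rewrite [X in dec X](_ : _ = nmem s1 aSecond) // eq1 inE.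
  rewrite -[X in _ = _ && X]subn_eq0 /=.
  by case: (_ \in _); case: (rk _ - _).
apply: (runs_le (T := 1 + 1)); last by lia.
apply: runs_seqk; apply: runs_query; set s3 := setn s2 _ _ _.
have i3 : nmem s3 aIndep 0 = (lpart A \in indep (mat1 I)) by exact: i2.
have a3 : nmem s3 aAns 0 = (rpart A \in indep (mat2 I)).
  by rewrite /s3 /= updE oracle_ofE /= -eq1.
clearbody s3; apply: runs_nset; rewrite /= updE /= i3 a3.
by do 2! case: (_ \in _).
Qed.

Definition full_pair j : bool :=
  (encode_set A j != 0) && (encode_set A (n + j) != 0).

Lemma sum_full_pair : \sum_(0 <= j < n) full_pair j = #|lpart A :&: rpart A|.
Proof.
rewrite big_mkord -sum1_card [RHS]big_mkcond; apply: eq_bigr => i _.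
rewrite /full_pair (encode_setE A (lshift n i)) (encode_setE A (rshift n i)) !inE.
by do 2! case: (_ \in A).
Qed.

Lemma runs_count s : agree_off (aBound :: rank_scratch) s0 s -> nmem s aAns 0 = 0 ->
  runs O (For CountStep) s (n * 4 + 2) (fun s' =>
    nmem s' aBound 0 = nmem s aBound 0 /\
    nmem s' aAns 0 = #|lpart A :&: rpart A|).
Proof.
move=> sm ans0.
pose Inv i s' := [/\ agree_off [:: aAns; aCtr] s s' &
  nmem s' aAns 0 = \sum_(0 <= j < i) full_pair j].
have [||t [s' [ex le [_ [sm' ans']]]]] := @runs_for _ O n 2 CountStep Inv s (sm 0 0 isT).
- by split; [apply: agree_off_setn|rewrite /= /upd /= ans0 big_geq].
- move=> i s1 lt ctr1 sn1 [sm1 ans1].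
  have full1 : beval s1 (BAnd (NLe (NConst 1) (NGet aSol idx))
      (NLe (NConst 1) second_elt)) = full_pair i.
    by rewrite /= ctr1 sn1 !sm1 // !sm // !lt0n.
  apply: runs_if; rewrite full1 => bi.
    apply: runs_nset; split=> //; split; first by do 2! apply: agree_off_setn => //.
    by rewrite /= /upd /= big_nat_recr //= -ans1 bi.
  apply: runs_skip; split=> //; split; first by apply: agree_off_setn.
  by rewrite /= /upd /= big_nat_recr //= -ans1 (negPf bi) addn0.
by exists t, s'; split=> //; split; [rewrite sm'|rewrite ans' sum_full_pair].
Qed.

Lemma runs_sim2 delta : runs O (Sim2 delta) s0 (100 * n + 100)
  (outputs_bool (A \in few_pairs n (pair_bound delta I))).
Proof.
apply: (runs_le (T := (n * 10 + 6) + (1 + ((n * 4 + 2) + 1)))); last by lia.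
apply: (runs_seq (Q1 := fun s1 => agree_off (aBound :: rank_scratch) s0 s1 /\
  nmem s1 aBound 0 = pair_bound delta I)).
  rewrite /pair_bound; case: delta; last first.
    by apply: (runs_le (T := 1)); [exact: runs_skip|lia].
  apply: (runs_le (T := (n * 10 + 5) + 1)); last by lia.
  apply: runs_seq; first by apply: (@runs_rank _ _ false _ (fun=> 1)).
  move=> s1 [sm1 r1]; apply: runs_nset; split.
    apply: agree_off_setn => //; apply: agree_off_trans sm1 => // x hx.
    by rewrite inE hx orbT.
  by rewrite /= updE /= r1 dec_full rankT sm1.
move=> s1 [sm1 b1]; apply: runs_seqk; apply: runs_nset.
set s2 := setn _ _ _ _; apply: runs_seq.
  by apply: runs_count => //; apply: agree_off_setn.
move=> s3 [b3 a3]; apply: runs_nset.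
rewrite /outputs_bool /= updE /= a3 b3 /s2 /= /upd /= b1 inE.
by rewrite -lt0n subn_gt0 addn1 ltnS.
Qed.

(** The decoded output is [lpart A] and [flip delta (rpart A)], and the flag tells
    whether both are bases, which is the case distinction of [reduced_correct]. *)
Lemma runs_extract delta : wmi_optimal (reduced delta I) A ->
  runs O (Extract delta) s0 (100 * n + 100) (outputs_solution (cmp_of delta) I).
Proof.
move=> optA.
apply: (runs_le (T := (n * 3 + 2) + ((n * 20 + 14) + ((n * 20 + 14) +
  ((n * 3 + 2) + ((n * 3 + 2) + 1)))))); last by lia.
apply: runs_seq; first exact: runs_second.
move=> s1 [sm1 Y1].
have sn1 : nmem s1 aSize 0 = n by rewrite sm1.
apply: runs_seq; first exact: runs_base.
move=> s2 [sm2 b2].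
have sn2 : nmem s2 aSize 0 = n by rewrite sm2.
apply: runs_seq; first exact: runs_base.
move=> s3 [sm3 b3].
have sn3 : nmem s3 aSize 0 = n by rewrite sm3.
apply: runs_seq.
  exact: (@runs_fill _ O n [:: 1; aCtr] 1 _ _ s3 isT isT isT isT sn3 (reads_array _)).
move=> s4 [sm4 X4].
have sn4 : nmem s4 aSize 0 = n by rewrite sm4.
apply: runs_seq.
  exact: (@runs_fill _ O n [:: 2; aCtr] 2 _ _ s4 isT isT isT isT sn4 (reads_array _)).
move=> s5 [sm5 Y5]; apply: runs_nset.
set s6 := setn _ _ _ _.
have decX : dec (nmem s6 1) = lpart A.
  rewrite -dec_lpart; apply: decode_set_ext => j lt.
  by rewrite /s6 /= /upd /= sm5 // X4 // sm3 // sm2 // sm1.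
have decY : dec (nmem s6 2) = flip delta (rpart A).
  rewrite -dec_rpart -Y1; apply: decode_set_ext => j lt.
  by rewrite /s6 /= /upd /= Y5 // sm4 // sm3 // sm2.
have b10 : nmem s5 aBase1 0 = (lpart A \in bases (mat1 I)).
  rewrite sm5 // sm4 // sm3 // b2 -dec_lpart.
  by rewrite (decode_set_ext (v := encode_set A)) // => j _; rewrite sm1.
have b11 : nmem s5 aBase2 0 = (flip delta (rpart A) \in bases (mat2 I)).
  rewrite sm5 // sm4 // b3 -dec_rpart -Y1.
  by rewrite (decode_set_ext (v := nmem s1 aSecond)) // => j _; rewrite sm2.
have flag : (nmem s6 0 0 != 0) = (lpart A \in bases (mat1 I)) &&
    (flip delta (rpart A) \in bases (mat2 I)).
  by rewrite /s6 /= updE /= b10 b11; do 2! case: (_ \in _).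
by rewrite /outputs_solution flag decX decY; exact: reduced_correct.
Qed.

End Programs.

Section Construction.
Variables (R : realType) (I : instance R).
Local Notation n := (isize I).
Local Notation O := (oracle_of I).
Implicit Types s : store R.

Lemma runs_add_abs a s (Q : store R -> Prop) :
  Q (setr s 2 0 (rmem s 2 0 + `|rmem s a (nmem s aCtr 0)|)%R) ->
  runs O (AddAbs a) s 2 Q.
Proof.
move=> q; apply: runs_if => /= h; apply: runs_rset => /=.
  by rewrite -[X in (_ + X)%R]ger0_norm.
by rewrite -ler0_norm // ltW // ltNge.
Qed.

Lemma encode_funE (m : nat) (c : 'I_m -> R) (i : 'I_m) : encode_fun c i = c i.
Proof. by rewrite /encode_fun valK. Qed.

Let s0 := initial I (fun=> 0).

Lemma runs_construct delta :
  runs O (Construct delta) s0 (100 * n + 100) (outputs_wmi (reduced delta I)).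
Proof.
pose c a j := rmem s0 a j.
pose total := (fun i => 1 + \sum_(0 <= j < i) (`|c 0 j| + `|c 1 j|))%R.
pose C := total n.
pose d2 j := (if delta then - c 1 j else c 1 j)%R.
apply: (runs_le (T := 1 + ((n * 6 + 2) + ((n * 4 + 2) + 1)))); last by lia.
apply: runs_seqk; apply: runs_rset.
set s1 := setr _ _ _ _.
pose Inv1 i s := (forall a j, a < 2 -> rmem s a j = c a j) /\ rmem s 2 0 = total i.
apply: runs_seq.
  apply: (@runs_for _ O n 4 _ Inv1) => //.
    split; first by move=> [|[|]].
    by rewrite /= /upd /= /total big_geq // addr0.
  move=> i s lt ctr sn [cs ts].
  apply: (runs_le (T := 2 + 2)) => //.
  apply: runs_seqk; apply: runs_add_abs; apply: runs_add_abs.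
  split=> //; split; first by move=> [|[|]] // j _; rewrite /= /upd /= cs.
  by rewrite /= /upd /= ctr ts !cs // /total big_nat_recr //= !addrA.
move=> s2 [sn2 [cs2 ts2]].
pose Inv2 i s := [/\ rmem s 2 0 = C, forall j, rmem s 1 j = c 1 j,
  forall j, j < n -> rmem s 0 j = if j < i then (C - c 0 j)%R else c 0 j &
  forall j, j < i -> rmem s 0 (n + j) = (C - d2 j)%R].
apply: runs_seq.
  apply: (@runs_for _ O n 2 _ Inv2) => //.
    by split=> // j; [exact: cs2|rewrite cs2].
  move=> i s lt ctr sn [Cs c2s c1s wt].
  apply: (runs_le (T := 1 + 1)) => //; apply: runs_seqk; apply: runs_rset; apply: runs_rset.
  split=> //; split.
  - by rewrite /= /upd.
  - exact: c2s.
  - move=> j jn; rewrite /= /upd /= ctr sn.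
    have -> : (j == n + i) = false by lia.
    have -> : (i == n + i) = false by lia.
    rewrite Cs c1s // ltnn ltnS leq_eqVlt.
    by case: eqVneq => [->|_] /=; last exact: c1s.
  - move=> j; rewrite ltnS => ji; rewrite /= /upd /= ctr sn.
    have -> : (n + j == i) = false by lia.
    rewrite eqn_add2l; case: eqVneq => [->|ne].
      by rewrite /d2; case: (delta) => /=; rewrite ctr Cs c2s ?opprK.
    by apply: wt; lia.
move=> s3 [sn3 [Cs3 c2s3 c1s3 wt3]]; apply: runs_nset.
have bigC : big_cost (@cost1 R I) (@second_cost R delta I) = C.
  rewrite /big_cost /C /total big_mkord; congr (_ + _)%R.
  apply: eq_bigr => i _; rewrite /c /= !encode_funE /second_cost.
  by case: (delta); rewrite ?normrN.
split=> [|e]; first by rewrite /= updE /= sn3.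
case: (split_ordP e) => i -> /=.
  by rewrite c1s3 //= ltn_ord big_weight_l bigC /c /= encode_funE.
rewrite wt3 // big_weight_r bigC /d2 /c /= encode_funE.
by rewrite /second_cost.
Qed.

End Construction.

Lemma horner_affine (a b x : nat) : (a *: 'X + b%:P).[x]%R = a * x + b.
Proof. by rewrite hornerD hornerZ hornerX hornerC. Qed.

Lemma reducible_cmp (R : realType) delta : reducible_to_wmi R (cmp_of delta).
Proof.
exists (Construct delta), (Sim1 delta), (Sim2 delta), (Extract delta).
(* The extraction is the longest program, with at most [49 * n + 35] steps. *)
exists (100%N *: 'X + 100%N%:P)%R => I; exists (reduced delta I).
rewrite horner_affine /=.
split; first by lia.
- exact: runs_construct.
- by move=> S; split; [exact: runs_sim1|exact: runs_sim2].
- by move=> A; exact: runs_extract.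
Qed.

Theorem theorem1 (R : realType) :
  reducible_to_wmi R P_le /\ reducible_to_wmi R P_ge.
Proof. by split; [exact: (reducible_cmp R false)|exact: (reducible_cmp R true)]. Qed.
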